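(* The Popp volume $\mathcal{P}_Q$ of the quaternionic contact structure $\mathbb{S}^7_Q=(\mathbb{S}^7,\mathcal{H}_Q,\langle\cdot,\cdot\rangle)$ equals the standard volume form $d\sigma$ of $\mathbb{S}^7$ up to a constant factor.
   Context: $\mathbb{S}^7\subset\mathbb{H}^2\cong\mathbb{R}^8$ is the unit sphere with the standard Riemannian metric and standard volume form $d\sigma$. Let $V_{\bf i}(q)=q{\bf i}$, $V_{\bf j}(q)=q{\bf j}$, $V_{\bf k}(q)=q{\bf k}$ (right multiplication on $\mathbb{H}^2$). The distribution $\mathcal{H}_Q\subset T\mathbb{S}^7$ is the rank $4$ orthogonal complement of $\mathrm{Span}\{V_{\bf i},V_{\bf j},V_{\bf k}\}$ in $T\mathbb{S}^7$ (it is bracket generating of step two), and $\langle\cdot,\cdot\rangle$ is the restriction of the standard metric to $\mathcal{H}_Q$. Popp measure: Let $(M,\mathcal{H},\langle\cdot,\cdot\rangle)$ be a step two regular subriemannian manifold of dimension $n$ and rank $m$ (so $\mathcal{H}+[\mathcal{H},\mathcal{H}]=TM$). Choose a local adapted frame $X_1,\dots,X_n$, i.e. a local frame of $TM$ such that $X_1,\dots,X_m$ is an orthonormal frame of $\mathcal{H}$; let $\eta_1,\dots,\eta_n$ be the dual coframe and, for $1\le i,j\le m$ and $m+1\le k\le n$, let $b_{ij}^k=\eta_k([X_i,X_j])$. Put $B^{kl}=\sum_{i,j=1}^m b_{ij}^kb_{ij}^l$ for $m+1\le k,l\le n$, and $B=(B^{kl})$. The Popp measure (volume) is $\mathcal{P}=\frac{1}{\sqrt{\det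 B}}\,\eta_1\wedge\cdots\wedge\eta_n$; it does not depend (up to orientation) on the adapted frame. *)

(* Defs.v *)
From HB Require Import structures.
From mathcomp Require Import all_boot all_order all_algebra.
From mathcomp Require Import all_classical all_reals all_analysis.

Set Implicit Arguments.
Unset Strict Implicit.
Unset Printing Implicit Defensive.

Import Order.TTheory GRing.Theory Num.Theory.
Import numFieldNormedType.Exports.

Local Open Scope classical_set_scope.
Local Open Scope ring_scope.

Section EuclideanCalculus.
Context {R : realType} {N : nat}.
Local Notation E := 'rV[R]_N.

Definition dot (u v : E) : R := \sum_(i < N) u 0 i * v 0 i.

Fixpoint Ck (k : nat) (U : set E) (f : E -> E) : Prop :=
  match k with
  | 0%N => forall q, U q -> {for q, continuous f}
  | k'.+1 => (forall q, U q -> differentiable f q) /\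
             (forall v : E, Ck k' U (fun q => 'D_v f q))
  end.

Definition smooth_on (U : set E) (f : E -> E) : Prop := forall k, Ck k U f.

Definition lie_bracket (X Y : E -> E) : E -> E :=
  fun q => 'D_(X q) Y q - 'D_(Y q) X q.

End EuclideanCalculus.

(* [M] is an embedded submanifold of R^N of dimension [m + r], [TM q] is its
   tangent space at [q], and [H q] is the fibre at [q] of a step two
   distribution of rank [m], carrying the restriction of the Euclidean inner
   product. A smooth local vector field on [M] is represented by a smooth field
   on an open subset [U] of R^N which is tangent to [M] along [M]: every smooth
   field on a small enough open subset of [M] is of this form, and the bracket
   of two fields tangent to [M] depends, at the points of [M], only on their
   restrictions to [M]. The horizontal fields of an adapted frame are those
   indexed by [lshift r i], the other ones those indexed by [rshift m k]. *)
Section PoppVolume.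
Context {R : realType} {N : nat} (m r : nat).
Local Notation E := 'rV[R]_N.
Variables (M : set E) (TM H : E -> set E).
Implicit Types (X : 'I_(m + r) -> E -> E) (v : 'I_(m + r) -> E).

Definition frame_mx X (q : E) : 'M[R]_(m + r, N) :=
  \matrix_(i < m + r) X i q.

Definition adapted_frame (U : set E) X : Prop :=
  [/\ open U,
      forall i, smooth_on U (X i),
      forall q, U q -> M q ->
        row_free (frame_mx X q) /\
        (forall w : E, TM q w <-> (w <= frame_mx X q)%MS),
      forall q, U q -> M q -> forall i j : 'I_m,
        dot (X (lshift r i) q) (X (lshift r j) q) = (i == j)%:R &
      forall q, U q -> M q -> forall w : E,
        H q w <-> (w <= usubmx (frame_mx X q))%MS].

(* [coframe X k q w] is the [k]-th coordinate of [w] in the basis of [TM q]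
   given by the frame. *)
Definition coframe X (k : 'I_(m + r)) (q w : E) : R :=
  (w *m pinvmx (frame_mx X q)) 0 k.

Definition structure_fun X (i j : 'I_m) (k : 'I_r) (q : E) : R :=
  coframe X (rshift m k) q
    (lie_bracket (X (lshift r i)) (X (lshift r j)) q).

Definition popp_mx X (q : E) : 'M[R]_r :=
  \matrix_(k, l) \sum_(i < m) \sum_(j < m)
     structure_fun X i j k q * structure_fun X i j l q.

(* The determinant is the value of the wedge product of the coframe on [v]. *)
Definition popp_form X (q : E) v : R :=
  (Num.sqrt (\det (popp_mx X q)))^-1 *
  \det (\matrix_(i, j) coframe X i q (v j)).

(* The form given by an adapted frame depends on the frame up to a sign, so the
   Popp volume of [M] is taken relative to an orientation of [M], here the one
   for which a frame is positive when the volume form [o] is positive on it. *)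
Definition is_popp_volume (o : E -> ('I_(m + r) -> E) -> R)
    (omega : E -> ('I_(m + r) -> E) -> R) : Prop :=
  forall (U : set E) X, adapted_frame U X ->
  forall q, U q -> M q -> forall v, (forall j, TM q (v j)) ->
    omega q v = Num.sg (o q (fun i => X i q)) * popp_form X q v.

End PoppVolume.

Section QuaternionicContactS7.
Context {R : realType}.

(* A quaternion a + b i + c j + d k is the row vector of a, b, c, d. *)
Definition quat (a b c d : R) : 'rV[R]_4 := \row_k [:: a; b; c; d]`_k.

Definition qmul (x y : 'rV[R]_4) : 'rV[R]_4 :=
  let x0 := x 0 (inord 0) in let x1 := x 0 (inord 1) in
  let x2 := x 0 (inord 2) in let x3 := x 0 (inord 3) in
  let y0 := y 0 (inord 0) in let y1 := y 0 (inord 1) in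
  let y2 := y 0 (inord 2) in let y3 := y 0 (inord 3) in
  quat (x0 * y0 - x1 * y1 - x2 * y2 - x3 * y3)
       (x0 * y1 + x1 * y0 + x2 * y3 - x3 * y2)
       (x0 * y2 - x1 * y3 + x2 * y0 + x3 * y1)
       (x0 * y3 + x1 * y2 - x2 * y1 + x3 * y0).

(* R^8 = R^(4 + 4) is identified with H^2 by splitting a row vector into its
   two halves. *)
Definition right_mul (u : 'rV[R]_4) (q : 'rV[R]_(4 + 4)) : 'rV[R]_(4 + 4) :=
  row_mx (qmul (lsubmx q) u) (qmul (rsubmx q) u).

Definition V_i := right_mul (quat 0 1 0 0).
Definition V_j := right_mul (quat 0 0 1 0).
Definition V_k := right_mul (quat 0 0 0 1).

Definition S7 : set 'rV[R]_(4 + 4) := [set q | dot q q = 1].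

Definition TS7 (q : 'rV[R]_(4 + 4)) : set 'rV[R]_(4 + 4) :=
  [set w | dot q w = 0].

Definition HQ (q : 'rV[R]_(4 + 4)) : set 'rV[R]_(4 + 4) :=
  [set w | TS7 q w /\
     forall v : 'rV[R]_(4 + 4),
       (v <= V_i q + V_j q + V_k q)%MS -> dot v w = 0].

(* The standard volume form: the contraction of the Euclidean volume form of
   R^8 with the outward unit normal, which is [q] at the point [q]. *)
Definition dsigma (q : 'rV[R]_(4 + 4)) (v : 'I_(4 + 3) -> 'rV[R]_(4 + 4)) : R :=
  \det (col_mx q (\matrix_(i < 4 + 3) v i) : 'M[R]_(4 + 4)).

End QuaternionicContactS7.

(* Main.v *)
(* Write W for the rows V_i q, V_j q, V_k q and let X be an adapted frame with
   horizontal part Xh and vertical part Xv. Differentiating <V_a p, X_j p> = 0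
   along the great circle through q with velocity X_i q gives
   <V_a q, [X_i, X_j] q> = - 2 <X_i a, X_j>. Right multiplication by a preserves
   the horizontal space, so by Parseval the Gram matrix of these numbers is 16
   times the identity; hence A^T B A = 16 for A = Xv W^T, and
   sqrt (det B) = 64 / |det A|. On the other hand, up to sign, dsigma takes the
   value det A on the frame, because (q, Xh, W) is an orthonormal basis of R^8.
   Thus the Popp form is dsigma / 64. For the equivalence, adapted frames must
   exist near each point: a local unit horizontal field Y gives the horizontal
   frame Y, Y i, Y j, Y k. *)
From HB Require Import structures.
Require Import Defs.
From mathcomp Require Import all_boot all_order all_algebra.
From mathcomp Require Import all_classical all_reals all_analysis.
From mathcomp Require Import ring lra.

Set Implicit Arguments.
Unset Strict Implicit.
Unset Printing Implicit Defensive.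

Import Order.TTheory GRing.Theory Num.Theory.
Import numFieldNormedType.Exports.

Local Open Scope classical_set_scope.
Local Open Scope ring_scope.

(** * The Euclidean inner product as a matrix product *)

Section Dot.
Context {R : realType} {N : nat}.
Implicit Types u v w : 'rV[R]_N.

Lemma dotE u v : dot u v = (u *m v^T) 0 0.
Proof. by rewrite mxE; apply: eq_bigr => i _; rewrite mxE. Qed.

Lemma dot_mulmx u v : u *m v^T = (dot u v)%:M.
Proof. by rewrite dotE -mx11_scalar. Qed.

Lemma dotC u v : dot u v = dot v u.
Proof. by apply: eq_bigr => i _; rewrite mulrC. Qed.

Lemma dotDr u v w : dot u (v + w) = dot u v + dot u w.
Proof. by rewrite !dotE linearD mulmxDr mxE. Qed.

Lemma dotZr a u v : dot u (a *: v) = a * dot u v.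
Proof. by rewrite !dotE linearZ -scalemxAr mxE. Qed.

Lemma dotDl u v w : dot (u + v) w = dot u w + dot v w.
Proof. by rewrite !(dotC _ w) dotDr. Qed.

Lemma dotZl a u v : dot (a *: u) v = a * dot u v.
Proof. by rewrite !(dotC _ v) dotZr. Qed.

Lemma dotNr u v : dot u (- v) = - dot u v.
Proof. by rewrite -scaleN1r dotZr mulN1r. Qed.

Lemma dot_sumr n u (v : 'I_n -> 'rV[R]_N) :
  dot u (\sum_(i < n) v i) = \sum_(i < n) dot u (v i).
Proof.
rewrite dotE (raddf_sum trmx) mulmx_sumr summxE.
by apply: eq_bigr => i _; rewrite dotE.
Qed.

Lemma dot_gt0 u : u != 0 -> 0 < dot u u.
Proof.
move=> u0; rewrite lt_def; apply/andP; split; last first.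
  by apply: sumr_ge0 => i _; rewrite -expr2 sqr_ge0.
apply: contra u0; rewrite psumr_eq0; last by move=> i _; rewrite -expr2 sqr_ge0.
move=> /allP h; apply/eqP/rowP => i; rewrite mxE.
by have := h i (mem_index_enum _); rewrite /= mulf_eq0 orbb => /eqP.
Qed.

Lemma dot_mxE m (A : 'M[R]_(m, N)) p (B : 'M[R]_(p, N)) i j :
  (A *m B^T) i j = dot (row i A) (row j B).
Proof. by rewrite mxE; apply: eq_bigr => k _; rewrite !mxE. Qed.

Lemma mul_tr_eq0 m (B : 'M[R]_(m, N)) q :
  (forall i, dot q (row i B) = 0) -> q *m B^T = 0 /\ B *m q^T = 0.
Proof.
move=> qB; have qBT : q *m B^T = 0.
  by apply/rowP => i; rewrite dot_mxE row_id qB mxE.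
by split=> //; rewrite -[LHS]trmxK trmx_mul trmxK qBT trmx0.
Qed.

End Dot.

(** * Right quaternion multiplication, vertical fields and the horizontal space *)

Section Quaternions.
Context {R : realType}.
Local Notation E := 'rV[R]_(4 + 4).

Lemma quatE (a b c d : R) :
  ((quat a b c d 0 (inord 0) = a) * (quat a b c d 0 (inord 1) = b) *
  (quat a b c d 0 (inord 2) = c) * (quat a b c d 0 (inord 3) = d))%type.
Proof. by rewrite !mxE !inordK. Qed.

Lemma sum_ord4 (F : 'I_4 -> R) : \sum_(i < 4) F i =
  F (inord 0) + F (inord 1) + F (inord 2) + F (inord 3).
Proof.
rewrite !big_ord_recr big_ord0 /= add0r.
by do !congr (_ + _); congr F; apply: val_inj; rewrite /= inordK.
Qed.

Lemma eq_quat (x y : 'rV[R]_4) :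
  x 0 (inord 0) = y 0 (inord 0) -> x 0 (inord 1) = y 0 (inord 1) ->
  x 0 (inord 2) = y 0 (inord 2) -> x 0 (inord 3) = y 0 (inord 3) -> x = y.
Proof.
move=> h0 h1 h2 h3; apply/rowP => -[[|[|[|[|//]]]] lt_i4].
- by rewrite (_ : Ordinal _ = inord 0) //; apply: val_inj; rewrite /= inordK.
- by rewrite (_ : Ordinal _ = inord 1) //; apply: val_inj; rewrite /= inordK.
- by rewrite (_ : Ordinal _ = inord 2) //; apply: val_inj; rewrite /= inordK.
- by rewrite (_ : Ordinal _ = inord 3) //; apply: val_inj; rewrite /= inordK.
Qed.

Lemma quat_coord (y : 'rV[R]_4) :
  y = quat (y 0 (inord 0)) (y 0 (inord 1)) (y 0 (inord 2)) (y 0 (inord 3)).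
Proof. by apply: eq_quat; rewrite quatE. Qed.

Lemma add_quat (a b c d a' b' c' d' : R) :
  quat a b c d + quat a' b' c' d' = quat (a + a') (b + b') (c + c') (d + d').
Proof. by apply: eq_quat; rewrite [LHS]mxE !quatE. Qed.

Lemma scale_quat (t a b c d : R) :
  t *: quat a b c d = quat (t * a) (t * b) (t * c) (t * d).
Proof. by apply: eq_quat; rewrite [LHS]mxE !quatE. Qed.

Lemma qmul_quat (x0 x1 x2 x3 y0 y1 y2 y3 : R) :
  qmul (quat x0 x1 x2 x3) (quat y0 y1 y2 y3) =
  quat (x0 * y0 - x1 * y1 - x2 * y2 - x3 * y3)
       (x0 * y1 + x1 * y0 + x2 * y3 - x3 * y2)
       (x0 * y2 - x1 * y3 + x2 * y0 + x3 * y1)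
       (x0 * y3 + x1 * y2 - x2 * y1 + x3 * y0).
Proof. by rewrite /qmul !quatE. Qed.

Lemma qmul_linear (u : 'rV[R]_4) : linear (qmul ^~ u).
Proof.
move=> a x y; rewrite (quat_coord x) (quat_coord y) (quat_coord u).
by rewrite !(scale_quat, add_quat, qmul_quat); congr quat; ring.
Qed.

Lemma right_mul_linear (u : 'rV[R]_4) : linear (right_mul u).
Proof.
move=> a x y; rewrite /right_mul !linearP.
by rewrite !qmul_linear -add_row_mx -scale_row_mx.
Qed.

(** The adjoint of right multiplication by [u] is right multiplication by its conjugate, which is
    [- u] when [u] is imaginary. *)
Lemma dot_right_mul (u : 'rV[R]_4) (x y : E) : u 0 (inord 0) = 0 ->
  dot (right_mul u x) y = - dot x (right_mul u y).
Proof.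
move=> u0; rewrite -[x in RHS]hsubmxK -[y in LHS]hsubmxK /right_mul.
have dot_row (a b c d : 'rV[R]_4) :
    dot (row_mx a b) (row_mx c d) = dot a c + dot b d.
  by rewrite !dotE tr_row_mx mul_row_col mxE.
rewrite !dot_row /dot !sum_ord4 !quatE u0; ring.
Qed.

Definition qunit (a : 'I_3) : 'rV[R]_4 :=
  [:: quat 0 1 0 0; quat 0 0 1 0; quat 0 0 0 1]`_a.

(** [V_i], [V_j], [V_k] as one family, so that their relations can be written with Kronecker
    deltas. *)
Definition vert (a : 'I_3) : E -> E := right_mul (qunit a).

HB.instance Definition _ a := GRing.isLinear.Build R E E *:%R (vert a)
  (right_mul_linear (qunit a)).

Lemma vert_skew a (x y : E) : dot (vert a x) y = - dot x (vert a y).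
Proof.
apply: dot_right_mul.
by case: a => -[|[|[|//]]] ? /=; rewrite quatE.
Qed.

Lemma vert_self a (x : E) : dot x (vert a x) = 0.
Proof. by have := vert_skew a x x; rewrite dotC; lra. Qed.

(** The product of two imaginary units is -1 if they agree and, up to sign, the third unit
    otherwise. The values of [t] and [c] stay hidden because orthogonality kills that term in every
    use. *)
Lemma vert_vert a b (x : E) :
  exists (t : R) (c : 'I_3),
    vert a (vert b x) = - (a == b)%:R *: x + t *: vert c x.
Proof.
suff [t [c h]] : exists (t : R) (c : 'I_3), forall y : 'rV[R]_4,
    qmul (qmul y (qunit b)) (qunit a) =
      - (a == b)%:R *: y + t *: qmul y (qunit c).
  exists t, c; rewrite /vert /right_mul row_mxKl row_mxKr !h.
  by rewrite -add_row_mx -!scale_row_mx hsubmxK.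
pose c0 := @Ordinal 3 0 isT; pose c1 := @Ordinal 3 1 isT.
pose c2 := @Ordinal 3 2 isT.
have eq_ord (i j : 'I_3) : (i == j) = (i == j :> nat) by [].
have qring c t : (forall y0 y1 y2 y3 : R, let y := quat y0 y1 y2 y3 in
      qmul (qmul y (qunit b)) (qunit a) =
        - (a == b)%:R *: y + t *: qmul y (qunit c)) ->
    exists (t : R) (c : 'I_3), forall y : 'rV[R]_4,
    qmul (qmul y (qunit b)) (qunit a) =
      - (a == b)%:R *: y + t *: qmul y (qunit c).
  by move=> h; exists t, c => y; rewrite (quat_coord y) h.
move: a b qring => [[|[|[|//]]] ?] [[|[|[|//]]] ?] qring; move: qring;
  rewrite /qunit eq_ord /= => qring.
(* The table of the products [qunit b * qunit a], in this order because [vert b] acts first; on the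
   diagonal [t] is 0 and [c] is arbitrary. *)
all: [> apply: (qring c0 0) | apply: (qring c2 (-1)) | apply: (qring c1 1)
   | apply: (qring c2 1) | apply: (qring c0 0) | apply: (qring c0 (-1))
   | apply: (qring c1 (-1)) | apply: (qring c0 1) | apply: (qring c0 0)].
all: move=> y0 y1 y2 y3 /=; rewrite !qmul_quat !scale_quat add_quat.
all: by congr quat; ring.
Qed.

Lemma dot_vert a b (x : E) : dot (vert a x) (vert b x) = (a == b)%:R * dot x x.
Proof.
have [t [c e]] := vert_vert a b x.
by rewrite vert_skew e dotDr !dotZr vert_self mulr0 addr0 mulNr opprK.
Qed.

Definition vert_mx (q : E) : 'M[R]_(3, 4 + 4) := \matrix_a vert a q.

Lemma HQP (q w : E) :
  HQ q w <-> dot q w = 0 /\ forall a, dot (vert a q) w = 0.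
Proof.
have V_iE : V_i q = vert (@Ordinal 3 0 isT) q by [].
have V_jE : V_j q = vert (@Ordinal 3 1 isT) q by [].
have V_kE : V_k q = vert (@Ordinal 3 2 isT) q by [].
split=> [[qw h]|[qw h]]; split=> //.
  move=> a; apply: h; move: a => [[|[|[|//]]] p].
  - rewrite (_ : Ordinal p = @Ordinal 3 0 isT) -?V_iE; last exact: val_inj.
    by rewrite -addsmxA addsmxSl.
  - rewrite (_ : Ordinal p = @Ordinal 3 1 isT) -?V_jE; last exact: val_inj.
    by rewrite (submx_trans (addsmxSr (V_i q) (V_j q))) ?addsmxSl.
  - rewrite (_ : Ordinal p = @Ordinal 3 2 isT) -?V_kE; last exact: val_inj.
    by rewrite addsmxSr.
move=> v /sub_addsmxP[[A c] /= ->].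
have /sub_addsmxP[[a b] /= ->] := submxMl A (V_i q + V_j q)%MS.
rewrite !dotDl (mx11_scalar a) (mx11_scalar b) (mx11_scalar c) !mul_scalar_mx.
by rewrite !dotZl V_iE V_jE V_kE !h !mulr0 !addr0.
Qed.

(** Skewness moves the multiplication from [w] to [q] or to [vert b q], and the result is again a
    combination of [q] and vertical vectors, all orthogonal to [w]. *)
Lemma HQ_vert a (q w : E) : HQ q w -> HQ q (vert a w).
Proof.
move=> /HQP[qw h]; apply/HQP.
have skew x : dot x (vert a w) = - dot (vert a x) w by rewrite vert_skew opprK.
split=> [|b]; first by rewrite skew h oppr0.
have [t [c e]] := vert_vert a b q.
by rewrite skew e dotDl !dotZl qw h !mulr0 addr0 oppr0.
Qed.

Lemma row_vert_mx a (q : E) : row a (vert_mx q) = vert a q.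
Proof. by apply/rowP => l; rewrite !mxE. Qed.

Lemma vert_mx_tangent (q : E) a : dot q (row a (vert_mx q)) = 0.
Proof. by rewrite row_vert_mx vert_self. Qed.

Lemma vert_mx_orthonormal (q : E) : S7 q -> vert_mx q *m (vert_mx q)^T = 1%:M.
Proof.
move=> Sq; apply/matrixP => a b.
by rewrite dot_mxE !row_vert_mx dot_vert Sq mulr1 mxE.
Qed.

(** * The orthonormal basis of R^8 made of the normal, a horizontal basis and the vertical
    vectors *)

Section HorizontalBasis.
Variables (q : E) (F : 'M[R]_(4, 4 + 4)).
Hypotheses (HF : forall i, HQ q (row i F)) (oF : F *m F^T = 1%:M).
Local Notation W := (vert_mx q).
Local Notation G := (col_mx q (col_mx F W)).

Lemma horizontal_vert : F *m W^T = 0.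
Proof.
apply/matrixP => i a; rewrite dot_mxE row_vert_mx mxE dotC.
by have /HQP[_ ->] := HF i.
Qed.

Hypothesis Sq : S7 q.

Lemma horizontal_vert_orthonormal : G *m G^T = 1%:M.
Proof.
have [qF Fq] := mul_tr_eq0 (fun i => (HF i).1).
have [qW Wq] := mul_tr_eq0 (vert_mx_tangent q).
have WF : W *m F^T = 0.
  by rewrite -[LHS]trmxK trmx_mul trmxK horizontal_vert trmx0.
rewrite !tr_col_mx !mul_col_row mul_mx_row mul_col_mx.
rewrite qF qW Fq Wq WF horizontal_vert oF vert_mx_orthonormal //.
by rewrite dot_mulmx Sq row_mx0 col_mx0 -!scalar_mx_block.
Qed.

Lemma horizontal_vert_decomp (w : E) :
  w = dot q w *: q + (w *m F^T *m F + w *m W^T *m W).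
Proof.
(* The sizes [1 + (4 + 3)] and [4 + 4] are convertible; seen as a square matrix, [G] has its right
   inverse [G^T] also as a left inverse. *)
have GTG : (G : 'M[R]_(4 + 4))^T *m (G : 'M[R]_(4 + 4)) = 1%:M.
  by apply: mulmx1C; exact: horizontal_vert_orthonormal.
rewrite -{1}[w]mulmx1 -GTG mulmxA.
rewrite [LHS](_ : _ = w *m G^T *m G) //.
by rewrite !tr_col_mx !mul_mx_row !mul_row_col dot_mulmx mul_scalar_mx dotC.
Qed.

Lemma horizontal_proj (w : E) : HQ q w -> w *m F^T *m F = w.
Proof.
move=> /HQP[qw Vw].
have wW : w *m W^T = 0.
  by apply/rowP => a; rewrite dot_mxE row_id row_vert_mx dotC Vw mxE.
by rewrite [RHS]horizontal_vert_decomp qw wW scale0r add0r mul0mx addr0.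
Qed.

Lemma tangentP (w : E) : TS7 q w <-> (w <= col_mx F W)%MS.
Proof.
split=> [qw|/submxP[c ->]].
  rewrite [w]horizontal_vert_decomp qw scale0r add0r -mul_row_col.
  exact: submxMl.
have tangent_add m (A : 'M[R]_(1, m)) (B : 'M[R]_(m, 4 + 4)) :
    q *m B^T = 0 -> dot q (A *m B) = 0.
  by move=> qB; rewrite dotE trmx_mul mulmxA qB mul0mx mxE.
have [qF _] := mul_tr_eq0 (fun i => (HF i).1).
have [qW _] := mul_tr_eq0 (vert_mx_tangent q).
by rewrite /TS7 /= tangent_add // tr_col_mx mul_mx_row qF qW row_mx0.
Qed.

Lemma horizontalP (w : E) : HQ q w <-> (w <= F)%MS.
Proof.
split=> [/horizontal_proj <-|/submxP[c ->]]; first exact: submxMl.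
have [qF _] := mul_tr_eq0 (fun i => (HF i).1).
apply/HQP; split=> [|a]; first by rewrite dotE trmx_mul mulmxA qF mul0mx mxE.
have -> : dot (vert a q) (c *m F) = ((c *m F) *m W^T) 0 a.
  by rewrite dot_mxE row_id row_vert_mx dotC.
by rewrite -mulmxA horizontal_vert mulmx0 mxE.
Qed.

Lemma tangent_basis_free : row_free (col_mx F W).
Proof.
apply/row_freeP; exists (col_mx F W)^T.
have WF : W *m F^T = 0.
  by rewrite -[LHS]trmxK trmx_mul trmxK horizontal_vert trmx0.
rewrite tr_col_mx mul_col_row oF WF horizontal_vert vert_mx_orthonormal //.
by rewrite -scalar_mx_block.
Qed.

End HorizontalBasis.

End Quaternions.

(** * Differentiation along great circles of the sphere *)

Section SphereDerivative.
Context {R : realType} {N : nat}.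
Local Notation E := 'rV[R]_N.

Lemma dot_linear (u : E) : linear (dot u).
Proof. by move=> a x y; rewrite dotDr dotZr. Qed.

HB.instance Definition _ u := GRing.isLinear.Build R E R *%R (dot u)
  (dot_linear u).

Lemma differentiable_dot (u p : E) : differentiable (dot u : E -> R) p.
Proof.
have -> : (dot u : E -> R) = \sum_(i < N) (fun x : E => u 0 i *: (x 0 i : R)).
  by apply/funext => x; rewrite fct_sumE.
apply: differentiable_sum => i; apply: differentiableZ.
exact: differentiable_coord.
Qed.

Lemma diff_dot (u p : E) : 'd (dot u : E -> R) p = dot u :> (E -> R).
Proof.
by apply: diff_lin => x; exact/differentiable_continuous/differentiable_dot.
Qed.

(** The relation between [L] and [X] is known on the sphere only, so it is differentiated along a
    curve that stays there: the great circle through [q] with unit velocity [w]. *)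
Lemma sphere_derive_dot (L : {linear E -> E}) (X : E -> E) (q w : E) :
  differentiable X q -> dot q q = 1 -> dot w w = 1 -> dot q w = 0 ->
  (\forall p \near q, dot p p = 1 -> dot (L p) (X p) = 0) ->
  dot (L w) (X q) + dot (L q) ('D_w X q) = 0.
Proof.
move=> dX qq ww qw LX0.
pose g (t : R) : E := cos t *: q + sin t *: w.
have g0 : g 0 = q by rewrite /g cos0 sin0 scale1r scale0r addr0.
have sphere_g t : dot (g t) (g t) = 1.
  rewrite /g dotDl !dotDr !dotZl !dotZr qq ww qw (dotC w) qw.
  by rewrite !mulr0 !mulr1 addr0 add0r -!expr2 cos2Dsin2.
have dcos : is_derive (0 : R) 1 (@cos R) 0.
  by apply: is_derive_eq; rewrite sin0 oppr0.
have dsin : is_derive (0 : R) 1 (@sin R) 1.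
  by apply: is_derive_eq; rewrite cos0.
have dcos' : differentiable (@cos R) 0 by apply/derivable1_diffP; case: dcos.
have dsin' : differentiable (@sin R) 0 by apply/derivable1_diffP; case: dsin.
have dcosq := differentiableZl q dcos'.
have dsinw := differentiableZl w dsin'.
have dg : differentiable g 0 by exact: differentiableD.
have dcos1 : 'd (@cos R) 0 1 = 0 by rewrite -deriveE // derive_val.
have dsin1 : 'd (@sin R) 0 1 = 1 by rewrite -deriveE // derive_val.
have dcosq1 := congr1 (@^~ 1) (diffZl q dcos').
have dsinw1 := congr1 (@^~ 1) (diffZl w dsin').
rewrite /= dcos1 scale0r in dcosq1; rewrite /= dsin1 scale1r in dsinw1.
have dg0 : 'd g 0 1 = w := etrans (congr1 (@^~ 1) (diffD dcosq dsinw))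
  (etrans (congr2 +%R dcosq1 dsinw1) (add0r w)).
have dXg u : is_derive (0 : R) 1 (fun t => dot u (X (g t))) (dot u ('D_w X q)).
  have dX' : differentiable X (g 0) by rewrite g0.
  have d1 : differentiable (X \o g) 0 by exact: differentiable_comp.
  have d2 : differentiable (dot u \o (X \o g)) 0.
    exact: differentiable_comp (differentiable_dot _ _).
  apply: DeriveDef; first exact: diff_derivable.
  rewrite deriveE // (diff_comp d1 (differentiable_dot _ _)) /= diff_dot.
  by rewrite (diff_comp dg dX') /= dg0 g0 deriveE.
(* Expanding [L (g t)] by linearity leaves scalar products of functions of [t], so the product rule
   suffices and [L] need not be differentiated. *)
pose h t := cos t * dot (L q) (X (g t)) + sin t * dot (L w) (X (g t)).
have hE t : h t = dot (L (g t)) (X (g t)).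
  by rewrite /g linearD !linearZ /= dotDl !dotZl.
have dh : is_derive (0 : R) 1 h (dot (L w) (X q) + dot (L q) ('D_w X q)).
  have dq := is_deriveM dcos (dXg (L q)).
  have dw := is_deriveM dsin (dXg (L w)).
  apply: is_derive_eq (is_deriveD dq dw) _.
  rewrite g0 cos0 sin0 scale1r scaler0 scale0r addr0 add0r.
  by rewrite /GRing.scale /= mulr1 addrC.
(* The relation holds on the sphere near [q]; continuity of [g] brings it back to [t] near 0. *)
have h0 : \forall t \near (0 : R), h t = cst 0 t.
  rewrite -g0 in LX0.
  have gLX0 : \forall t \near (0 : R), dot (g t) (g t) = 1 ->
      dot (L (g t)) (X (g t)) = 0 := differentiable_continuous dg LX0.
  near=> t; rewrite hE /=.
  by apply: (near gLX0 t).
have [_ <-] := dh.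
by rewrite (near_eq_derive _ h0) derive_cst.
Unshelve. all: by end_near. Qed.

End SphereDerivative.

(** * Brackets of the horizontal fields of an adapted frame *)

Section AdaptedFrame.
Context {R : realType}.
Local Notation E := 'rV[R]_(4 + 4).
Variables (U : set E) (X : 'I_(4 + 3) -> E -> E).
Hypothesis frameX : @adapted_frame R (4 + 4) 4 3 S7 TS7 HQ U X.

Lemma frame_horizontal p (i : 'I_4) : U p -> S7 p -> HQ p (X (lshift 3 i) p).
Proof.
move=> Up Sp; have [_ _ _ _ /(_ p Up Sp) ->] := frameX.
rewrite (_ : X _ p = row i (usubmx (frame_mx X p))) ?row_sub //.
by apply/rowP => k; rewrite !mxE.
Qed.

Lemma frame_dot p (i j : 'I_4) : U p -> S7 p ->
  dot (X (lshift 3 i) p) (X (lshift 3 j) p) = (i == j)%:R.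
Proof. by case: frameX => _ _ _ h _ Up Sp; apply: h. Qed.

(** A general [L] covers two cases: the identity shows that brackets are tangent to the sphere, and
    [vert a] gives their vertical components. *)
Lemma dot_lie_bracket (L : {linear E -> E}) q (i j : 'I_4) : U q -> S7 q ->
  (forall p w, HQ p w -> dot (L p) w = 0) ->
  dot (L q) (lie_bracket (X (lshift 3 i)) (X (lshift 3 j)) q) =
  dot (L (X (lshift 3 j) q)) (X (lshift 3 i) q) -
  dot (L (X (lshift 3 i) q)) (X (lshift 3 j) q).
Proof.
move=> Uq Sq L0; have [oU smX _ _ _] := frameX.
(* The vector [X_k q] is a unit tangent vector, hence a valid velocity for the great circle, and
   [X_l] is horizontal on the sphere near [q]. *)
have D (k l : 'I_4) : dot (L q) ('D_(X (lshift 3 k) q) (X (lshift 3 l)) q) =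
    - dot (L (X (lshift 3 k) q)) (X (lshift 3 l) q).
  apply/eqP; rewrite -addr_eq0 addrC; apply/eqP/sphere_derive_dot => //.
  - by have [/(_ q Uq)] := smX (lshift 3 l) 1%N.
  - by rewrite frame_dot ?eqxx.
  - by have [] := frame_horizontal k Uq Sq.
  - near=> p => Sp; apply/L0/frame_horizontal => //.
    by near: p; exact: open_nbhs_nbhs.
by rewrite /lie_bracket dotDr dotNr !D opprK addrC.
Unshelve. all: by end_near. Qed.

Lemma bracket_tangent q (i j : 'I_4) : U q -> S7 q ->
  TS7 q (lie_bracket (X (lshift 3 i)) (X (lshift 3 j)) q).
Proof.
move=> Uq Sq; rewrite /TS7 /=.
rewrite (dot_lie_bracket (L := idfun)) //=; last by move=> p w [].
by rewrite [X in X - _]dotC subrr.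
Qed.

Lemma bracket_vert a q (i j : 'I_4) : U q -> S7 q ->
  dot (vert a q) (lie_bracket (X (lshift 3 i)) (X (lshift 3 j)) q) =
  - 2 * dot (vert a (X (lshift 3 i) q)) (X (lshift 3 j) q).
Proof.
move=> Uq Sq; rewrite dot_lie_bracket //; last by move=> p w /HQP[_ ->].
by rewrite vert_skew dotC; ring.
Qed.

(** * The Popp matrix and the Popp form at a point of the sphere *)

Section AtPoint.
Variable q : E.
Hypotheses (Uq : U q) (Sq : S7 q).
Local Notation F := (frame_mx X q).
Local Notation Fh := (usubmx F).
Local Notation W := (vert_mx q).
Local Notation A := (dsubmx F *m W^T).

Lemma row_frame (k : 'I_(4 + 3)) : row k F = X k q.
Proof. by apply/rowP => l; rewrite !mxE. Qed.

Lemma row_frame_horizontal (i : 'I_4) : row i Fh = X (lshift 3 i) q.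
Proof. by rewrite -row_frame; apply/rowP => l; rewrite !mxE. Qed.

Lemma frame_tangent (k : 'I_(4 + 3)) : dot q (X k q) = 0.
Proof.
have [_ _ /(_ q Uq Sq)[_ /(_ (X k q)) TX] _ _] := frameX.
by apply/TX; rewrite -row_frame row_sub.
Qed.

Lemma Fh_orthonormal : Fh *m Fh^T = 1%:M.
Proof.
by apply/matrixP => i j; rewrite dot_mxE !row_frame_horizontal frame_dot // mxE.
Qed.

Lemma Fh_horizontal i : HQ q (row i Fh).
Proof. by rewrite row_frame_horizontal; exact: frame_horizontal. Qed.

Lemma frame_vert : F *m W^T = col_mx 0 A.
Proof.
by rewrite -{1}(vsubmxK F) mul_col_mx (horizontal_vert Fh_horizontal).
Qed.

Lemma coframeK w : TS7 q w -> w *m pinvmx F *m F = w.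
Proof.
have [_ _ /(_ q Uq Sq)[_ TX] _ _] := frameX.
by move=> /TX; exact: mulmxKpV.
Qed.

(** Expand the bracket in the frame and pair it with the rows of [W]: the horizontal coordinates
    vanish, and the vertical ones are the structure functions. *)
Lemma structure_fun_vert (i j : 'I_4) (a : 'I_3) :
  \sum_(k < 3) structure_fun X i j k q * A k a =
  - 2 * dot (vert a (X (lshift 3 i) q)) (X (lshift 3 j) q).
Proof.
rewrite -bracket_vert //; set w := lie_bracket _ _ _.
have -> : dot (vert a q) w = (w *m W^T) 0 a.
  by rewrite dot_mxE row_vert_mx row_id dotC.
have Tw : TS7 q w by exact: bracket_tangent.
rewrite -(coframeK Tw) -mulmxA frame_vert.
rewrite -[w *m _]hsubmxK mul_row_col mulmx0 add0r mxE.
by apply: eq_bigr => k _; rewrite /structure_fun /coframe [in RHS]mxE.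
Qed.

(** Parseval's identity; it is enough that one of the two vectors is horizontal, since it then
    equals its projection. *)
Lemma sum_dot_horizontal (x y : E) : HQ q x ->
  \sum_(j < 4) dot x (X (lshift 3 j) q) * dot y (X (lshift 3 j) q) = dot x y.
Proof.
move=> Hx.
have FhE (z : E) j : (z *m Fh^T) 0 j = dot z (X (lshift 3 j) q).
  by rewrite dot_mxE row_frame_horizontal row_id.
have xE := horizontal_proj Fh_horizontal Fh_orthonormal Sq Hx.
rewrite [RHS]dotC -[x in RHS]xE dotE trmx_mul mulmxA mxE; apply: eq_bigr => j _.
by rewrite [(x *m _)^T _ _]mxE !FhE mulrC.
Qed.

(** The left side is the sum of the Gram matrices of the rows [b i j *m A]. For fixed [i], Parseval
    over [j] gives (-2)^2 = 4 times the identity, because the vectors [vert a (X_i q)] are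
    orthonormal; the four values of [i] give 16. *)
Lemma popp_mx_vert : A^T *m popp_mx X q *m A = (16%:R)%:M.
Proof.
pose b i j : 'rV[R]_3 := \row_k structure_fun X i j k q.
have bA i j a : (b i j *m A) 0 a =
    - 2 * dot (vert a (X (lshift 3 i) q)) (X (lshift 3 j) q).
  by rewrite -structure_fun_vert mxE; apply: eq_bigr => k _; rewrite mxE.
have -> : popp_mx X q = \sum_(i < 4) \sum_(j < 4) (b i j)^T *m b i j.
  apply/matrixP => k l; rewrite summxE mxE; apply: eq_bigr => i _.
  rewrite summxE; apply: eq_bigr => j _.
  by rewrite mxE big_ord1 !mxE.
rewrite mulmx_sumr mulmx_suml; apply/matrixP => a c; rewrite summxE.
have sum_i (i : 'I_4) :
    (A^T *m (\sum_j (b i j)^T *m b i j) *m A) a c = 4 * (a == c)%:R.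
  rewrite mulmx_sumr mulmx_suml summxE.
  rewrite (_ : (a == c)%:R =
      dot (vert a (X (lshift 3 i) q)) (vert c (X (lshift 3 i) q))).
    rewrite -sum_dot_horizontal; last exact/HQ_vert/frame_horizontal.
    rewrite mulr_sumr; apply: eq_bigr => j _.
    rewrite -!mulmxA mulmxA -trmx_mul mxE big_ord1 mxE !bA.
    ring.
  by rewrite dot_vert frame_dot // eqxx mulr1.
rewrite (eq_bigr _ (fun i _ => sum_i i)) sumr_const card_ord mxE.
by rewrite -mulr_natl; case: (a == c) => /=; ring.
Qed.

Local Notation G := (col_mx q (col_mx Fh W)).

(** In the basis [G] the matrix of [q] and the frame is block lower triangular with diagonal blocks
    1, 1 and [A], so its determinant is [\det A]. *)
Lemma frame_G :
  col_mx q F *m G^T = block_mx 1%:M 0 0 (block_mx 1%:M 0 (dsubmx F *m Fh^T) A).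
Proof.
have [qFh _] := mul_tr_eq0 (fun i => (Fh_horizontal i).1).
have [qW _] := mul_tr_eq0 (vert_mx_tangent q).
have [_ Fq] := @mul_tr_eq0 _ _ _ F q (fun i => etrans
  (congr1 (dot q) (row_frame i)) (frame_tangent _)).
rewrite !tr_col_mx mul_col_row !mul_mx_row frame_vert qFh qW Fq row_mx0.
rewrite dot_mulmx Sq (_ : F *m Fh^T = col_mx 1%:M (dsubmx F *m Fh^T)).
  by rewrite -block_mxEh.
by rewrite -Fh_orthonormal -mul_col_mx vsubmxK.
Qed.

(** Squares remove the undetermined sign of [\det G], which is 1 or -1. *)
Lemma dsigma_frame_sqr : dsigma q (X ^~ q) ^+ 2 = \det A ^+ 2.
Proof.
have detG : \det (G : 'M[R]_(4 + 4)) ^+ 2 = 1.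
  have /(congr1 determinant) :=
    horizontal_vert_orthonormal Fh_horizontal Fh_orthonormal Sq.
  by rewrite det1 => <-; rewrite expr2 -{2}det_tr; apply/esym/det_mulmx.
have -> : \det A = dsigma q (X ^~ q) * \det (G : 'M[R]_(4 + 4)).
  have /(congr1 determinant) := frame_G.
  rewrite !det_lblock !det1 !mul1r => <-.
  by rewrite -(det_tr G); apply: det_mulmx.
by rewrite exprMn detG mulr1.
Qed.

Lemma dsigma_coframe v : (forall j, TS7 q (v j)) ->
  dsigma q v = \det (\matrix_(i, j) coframe X i q (v j)) * dsigma q (X ^~ q).
Proof.
move=> Tv; pose C : 'M[R]_(4 + 3) := \matrix_(i, j) coframe X i q (v j).
have vE : \matrix_(j < 4 + 3) v j = C^T *m F.
  apply/row_matrixP => j; rewrite rowK row_mul -{1}(coframeK (Tv j)).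
  by congr (_ *m _); apply/rowP => k; do 3 rewrite [in RHS]mxE.
rewrite /dsigma vE -det_tr -/C.
(* Adding the normal [q] as first row extends the change of basis by a block 1, which keeps its
   determinant. *)
have -> : col_mx q (C^T *m F) = block_mx 1%:M 0 0 C^T *m col_mx q F.
  by rewrite mul_block_col mul1mx !mul0mx addr0 add0r.
rewrite det_tr -[\det C]det_tr -[\det C^T]mul1r -[X in X * _ * _](det1 R 1).
rewrite -(det_lblock 1%:M 0).
exact: det_mulmx.
Qed.

Lemma popp_form_dsigma v : (forall j, TS7 q (v j)) ->
  Num.sg (dsigma q (X ^~ q)) * popp_form X q v = 64%:R^-1 * dsigma q v.
Proof.
move=> Tv; rewrite (dsigma_coframe Tv) /popp_form.
set D := dsigma q _; set C := \det (\matrix_(i, j) coframe X i q (v j)).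
(* The determinant of 16 times the identity of size 3 is 16^3 = 64^2. *)
have detB : D ^+ 2 * \det (popp_mx X q) = 64%:R ^+ 2.
  have /(congr1 determinant) := popp_mx_vert.
  rewrite !det_mulmx det_tr det_scalar dsigma_frame_sqr => h.
  by rewrite expr2 mulrAC h; ring.
have D0 : D != 0.
  apply: contra_eqN detB => /eqP ->.
  by rewrite expr0n mul0r eq_sym expf_eq0 pnatr_eq0.
(* The square root is thus 64 / |D|, and the orientation sign turns the |D| of the Popp form into
   D. *)
have -> : \det (popp_mx X q) = (64%:R / D) ^+ 2.
  by rewrite exprMn -detB exprVn mulrAC mulfV ?mul1r // expf_neq0.
rewrite sqrtr_sqr normrM normfV [X in X / _]ger0_norm // invf_div.
rewrite [in RHS](numEsg D) -/D; ring.
Qed.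

End AtPoint.

End AdaptedFrame.

(** * Smoothness of fields with elementary coordinates *)

Lemma near_eq_differentiable (R : numFieldType) (V W : normedModType R)
    (f g : V -> W) (x : V) :
  (\near x, f x = g x) -> differentiable f x -> differentiable g x.
Proof.
move=> fg df.
(* The first-order expansion of [f] at [x] is also one of [g], so both have the same
   differential. *)
have gE : g \o shift x = cst (g x) + 'd f x +o_ 0 id.
  apply/eqaddoP => eps eps0; have /eqaddoP/(_ _ eps0) := diff_locally df.
  have fg0 : \forall h \near (0 : V), f (h + x) = g (h + x).
    by move: fg; rewrite (near_shift 0 x) subr0.
  have <- := nbhs_singleton fg.
  apply: filterS2 fg0 => h /= fgh.
  rewrite -[(f \o _ - _) h]/(f (h + x) - _) -[(g \o _ - _) h]/(g (h + x) - _).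
  by rewrite fgh.
have dgE : 'd g x = 'd f x :> (V -> W).
  by apply: diff_unique gE; exact: diff_continuous.
by apply/diff_locallyP; rewrite dgE; split=> //; exact: diff_continuous.
Qed.

Section ElementaryFunctions.
Context {R : realType} {N : nat}.
Local Notation E := 'rV[R]_N.
Implicit Types (U : set E) (f g : E -> R) (F : E -> E).

(* Closed under derivatives, since [- 2 D rsqrt = rsqrt ^ 3]. *)
Inductive elementary U : (E -> R) -> Prop :=
| elementary_cst c : elementary U (fun=> c)
| elementary_coord i : elementary U (fun p => p 0 i)
| elementary_add f g : elementary U f -> elementary U g ->
    elementary U (fun p => f p + g p)
| elementary_mul f g : elementary U f -> elementary U g ->
    elementary U (fun p => f p * g p)
| elementary_rsqrt f : elementary U f -> (forall p, U p -> 0 < f p) ->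
    elementary U (fun p => (Num.sqrt (f p))^-1).

Lemma is_derive_rsqrt (x : R) : 0 < x ->
  is_derive x 1 (fun y : R => (Num.sqrt y)^-1) (- 2^-1 * (Num.sqrt x)^-1 ^+ 3).
Proof.
move=> x0; have dsqrt := is_derive1_sqrt x0.
have s0 : Num.sqrt x != 0 by rewrite gt_eqF // sqrtr_gt0.
apply: DeriveDef; first exact: derivableV.
rewrite deriveV //.
rewrite derive_val /GRing.scale /=.
by field.
Qed.

(** By induction on the construction. Derivatives are described on [U] only, where the arguments of
    the inverse square roots are positive. *)
Lemma elementary_derive U f : elementary U f ->
  (forall p, U p -> differentiable f p) /\
  (forall v, exists2 g, elementary U g & forall p, U p -> 'D_v f p = g p).
Proof.
elim=> {f} [c|i|f g _ [df Df] _ [dg Dg]|f g ef [df Df] eg [dg Dg]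
  |f ef [df Df] f0].
- split=> // v; exists (fun=> 0); first exact: elementary_cst.
  by move=> p _; exact: derive_cst.
- split=> [p _|v]; first exact: differentiable_coord.
  exists (fun=> v 0 i); first exact: elementary_cst.
  move=> p _; have := derive_mx (@derivable_id _ _ p v).
  by rewrite derive_id => /matrixP/(_ 0 i) ->; rewrite mxE.
- split=> [p Up|v]; first exact: differentiableD (df p Up) (dg p Up).
  have [f' ef' Ef] := Df v; have [g' eg' Eg] := Dg v.
  exists (fun p => f' p + g' p); first exact: elementary_add.
  move=> p Up; rewrite -Ef // -Eg //.
  by apply: deriveD; apply: diff_derivable; [exact: df | exact: dg].
- split=> [p Up|v]; first exact: differentiableM (df p Up) (dg p Up).
  have [f' ef' Ef] := Df v; have [g' eg' Eg] := Dg v.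
  exists (fun p => f p * g' p + g p * f' p).
    by apply: elementary_add; exact: elementary_mul.
  move=> p Up; rewrite -Ef // -Eg //.
  by apply: deriveM; apply: diff_derivable; [exact: df | exact: dg].
- have drsqrt p : U p -> differentiable (fun y : R => (Num.sqrt y)^-1) (f p).
    by move=> /f0 /is_derive_rsqrt [/derivable1_diffP].
  have dcomp p (Up : U p) := differentiable_comp (df p Up) (drsqrt p Up).
  split=> // v; have [f' ef' Ef] := Df v.
  exists (fun p => - 2^-1 * ((Num.sqrt (f p))^-1 * ((Num.sqrt (f p))^-1 *
    (Num.sqrt (f p))^-1)) * f' p).
    by do 4?[apply: elementary_mul=> //; try exact: elementary_rsqrt];
      exact: elementary_cst.
  move=> p Up; rewrite -Ef // !deriveE //; [|exact: df|exact: dcomp].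
  apply: etrans (congr1 (@^~ v) (diff_comp (df p Up) (drsqrt p Up))) _.
  (* A linear map on R is determined by its value at 1, which is the derivative of the inverse
     square root. *)
  rewrite /= -[X in 'd _ (f p) X]mulr1 [LHS]linearZ /=.
  rewrite -(@deriveE _ _ _ _ (f p) 1 (drsqrt p Up)).
  have [_ ->] := is_derive_rsqrt (f0 p Up).
  by rewrite /GRing.scale /=; ring.
Qed.

Lemma differentiable_coord_elementary U F p : open U -> U p ->
  (forall i, exists2 g, elementary U g & forall r, U r -> F r 0 i = g r) ->
  differentiable F p.
Proof.
move=> oU Up eF.
have {}eF i : exists g, elementary U g /\ forall r, U r -> F r 0 i = g r.
  by have [g eg Fg] := eF i; exists g.
have [g Fg] := choice eF.
apply: (@near_eq_differentiable _ _ _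
    (\sum_(i < N) (fun r => g i r *: (delta_mx 0 i : E)))); last first.
  apply: differentiable_sum => i; apply: differentiableZl.
  exact: (elementary_derive (Fg i).1).1.
near=> r; rewrite fct_sumE [RHS]row_sum_delta; apply: eq_bigr => i _.
by rewrite (Fg i).2 //; near: r; exact: open_nbhs_nbhs.
Unshelve. all: by end_near. Qed.

Lemma smooth_elementary U F : open U ->
  (forall i, elementary U (fun p => F p 0 i)) -> smooth_on U F.
Proof.
move=> oU eF k.
(* The induction needs this weaker form: a derivative of [F] has elementary coordinates only on
   [U]. *)
have {eF} : forall i,
    exists2 g, elementary U g & forall p, U p -> F p 0 i = g p.
  by move=> i; exists (fun p => F p 0 i).
elim: k F => [|k IH] F eF; have dF p : U p -> differentiable F p
  by move=> Up; exact: differentiable_coord_elementary eF.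
  by move=> p Up; apply/differentiable_continuous/dF.
split=> // v; apply: IH => i.
have [g eg Fg] := eF i; have [g' eg' Dg] := (elementary_derive eg).2 v.
exists g' => // p Up; rewrite derive_mx; last exact/diff_derivable/dF.
rewrite mxE -Dg //; apply: near_eq_derive; near=> r; apply: Fg.
by near: r; exact: open_nbhs_nbhs.
Unshelve. all: by end_near. Qed.

Lemma elementary_sum U n (f : 'I_n -> E -> R) :
  (forall i, elementary U (f i)) -> elementary U (fun p => \sum_(i < n) f i p).
Proof.
elim: n f => [|n IH] f ef.
  by under eq_fun do rewrite big_ord0; exact: elementary_cst.
under eq_fun do rewrite big_ord_recr /=.
by apply: elementary_add => //; exact: IH.
Qed.

Definition elementary_field U F : Prop :=
  forall i, elementary U (fun p => F p 0 i).

Lemma elementary_field_cst U w : elementary_field U (fun=> w).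
Proof. by move=> i; exact: elementary_cst. Qed.

Lemma elementary_field_id U : elementary_field U id.
Proof. by move=> i; exact: elementary_coord. Qed.

Lemma elementary_fieldD U F G : elementary_field U F -> elementary_field U G ->
  elementary_field U (fun p => F p + G p).
Proof.
by move=> eF eG i; under eq_fun do rewrite mxE; exact: elementary_add.
Qed.

Lemma elementary_fieldZ U f F : elementary U f -> elementary_field U F ->
  elementary_field U (fun p => f p *: F p).
Proof.
by move=> ef eF i; under eq_fun do rewrite mxE; exact: elementary_mul.
Qed.

Lemma elementary_field_sum U n (F : 'I_n -> E -> E) :
  (forall k, elementary_field U (F k)) ->
  elementary_field U (fun p => \sum_(k < n) F k p).
Proof.
move=> eF i; under eq_fun do rewrite summxE.
by apply: elementary_sum => k; exact: eF.
Qed.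

Lemma elementary_dot U F G : elementary_field U F -> elementary_field U G ->
  elementary U (fun p => dot (F p) (G p)).
Proof. by move=> eF eG; apply: elementary_sum => i; exact: elementary_mul. Qed.

Lemma elementary_field_linear U (L : {linear E -> E}) F :
  elementary_field U F -> elementary_field U (fun p => L (F p)).
Proof.
move=> eF; under eq_fun do rewrite [F _]row_sum_delta linear_sum.
apply: elementary_field_sum => k; under eq_fun do rewrite linearZ.
exact: elementary_fieldZ (elementary_field_cst _ _).
Qed.

End ElementaryFunctions.

(** * Existence of an adapted frame near each point of the sphere *)

Section FrameExistence.
Context {R : realType}.
Local Notation E := 'rV[R]_(4 + 4).

(** Four linear conditions on R^8 have a nonzero solution. *)
Lemma horizontal_nonzero (q : E) : exists2 e, e != 0 & HQ q e.
Proof.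
pose C : 'M[R]_(4 + 4, 1 + 3) := (col_mx q (vert_mx q))^T.
have : kermx C != 0.
  rewrite -mxrank_eq0 mxrank_ker subn_eq0 -ltnNge.
  exact: leq_ltn_trans (rank_leq_col C) _.
move=> /rowV0Pn[e /sub_kermxP eC e0]; exists e => //.
move: eC; rewrite /C tr_col_mx mul_mx_row => /eqP.
rewrite row_mx_eq0 => /andP[/eqP eq0 /eqP eV].
apply/HQP; split=> [|a]; first by rewrite dotC dotE eq0 mxE.
by rewrite -row_vert_mx -(row_id 0 e) dotC -dot_mxE eV mxE.
Qed.

(* On the sphere this is the orthogonal projection of [e] on [HQ p]. *)
Definition horizontal_field (e p : E) : E :=
  e + (- dot e p *: p + \sum_(a < 3) - dot e (vert a p) *: vert a p).

Lemma horizontal_fieldP (e p : E) : S7 p -> HQ p (horizontal_field e p).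
Proof.
move=> Sp; apply/HQP; rewrite /horizontal_field; split=> [|a].
  have sum0 : dot p (\sum_(a < 3) - dot e (vert a p) *: vert a p) = 0.
    by rewrite dot_sumr big1 // => a _; rewrite dotZr vert_self mulr0.
  by rewrite !dotDr dotZr Sp mulr1 sum0 addr0 dotC subrr.
have sumE : dot (vert a p) (\sum_(b < 3) - dot e (vert b p) *: vert b p) =
    - dot e (vert a p).
  rewrite dot_sumr (bigD1 a) //= big1 => [|b ba].
    by rewrite dotZr dot_vert eqxx Sp !mulr1 addr0.
  by rewrite dotZr dot_vert eq_sym (negbTE ba) mul0r mulr0.
rewrite !dotDr dotZr [dot (vert a p) p]dotC vert_self mulr0 add0r sumE.
by rewrite dotC subrr.
Qed.

Lemma horizontal_field_id (q e : E) : HQ q e -> horizontal_field e q = e.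
Proof.
move=> /HQP[qe Ve]; rewrite /horizontal_field dotC qe oppr0 scale0r add0r.
by rewrite big1 ?addr0 // => a _; rewrite dotC Ve oppr0 scale0r.
Qed.

Lemma elementary_horizontal_field U e :
  elementary_field U (horizontal_field e).
Proof.
have opp f : elementary U f -> elementary U (fun p => - f p).
  move=> ef; under eq_fun do rewrite -mulN1r.
  exact: elementary_mul (elementary_cst _ _) ef.
have eV a : elementary_field U (vert a).
  exact: elementary_field_linear (elementary_field_id U).
apply: elementary_fieldD; first exact: elementary_field_cst.
apply: elementary_fieldD.
  apply: elementary_fieldZ (elementary_field_id U); apply: opp.
  exact: elementary_dot (elementary_field_cst _ _) (elementary_field_id U).
apply: elementary_field_sum => a; apply: elementary_fieldZ (eV a); apply: opp.
exact: elementary_dot (elementary_field_cst _ _) (eV a).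
Qed.

(** The frame Y, Y i, Y j, Y k: [unlift] renumbers the indices other than [ord0] as imaginary
    units. *)
Definition horizontal_frame (Y : E -> E) (i : 'I_4) (p : E) : E :=
  if unlift ord0 i is Some a then vert a (Y p) else Y p.

Definition tangent_frame (Y : E -> E) (k : 'I_(4 + 3)) (p : E) : E :=
  match fintype.split k with
  | inl i => horizontal_frame Y i p
  | inr a => vert a p
  end.

Lemma horizontal_frame_dot Y i j p : dot (Y p) (Y p) = 1 ->
  dot (horizontal_frame Y i p) (horizontal_frame Y j p) = (i == j)%:R.
Proof.
move=> Y1; rewrite /horizontal_frame.
case: (unliftP ord0 i) => [a|] ->; case: (unliftP ord0 j) => [b|] ->.
- by rewrite dot_vert Y1 mulr1 (inj_eq lift_inj).
- by rewrite dotC vert_self.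
- by rewrite vert_self.
- by rewrite Y1 eqxx.
Qed.

Lemma tangent_frame_mx Y p : frame_mx (tangent_frame Y) p =
  col_mx (\matrix_i horizontal_frame Y i p) (vert_mx p).
Proof.
apply/row_matrixP => k; rewrite rowK /tangent_frame -[in RHS](splitK k).
case: (fintype.split k) => [i|a] /=; first by rewrite rowKu rowK.
by rewrite rowKd rowK.
Qed.

Lemma adapted_tangent_frame U Y : open U -> elementary_field U Y ->
  (forall p, U p -> S7 p -> HQ p (Y p) /\ dot (Y p) (Y p) = 1) ->
  @adapted_frame R (4 + 4) 4 3 S7 TS7 HQ U (tangent_frame Y).
Proof.
move=> oU eY HY.
have HF p : U p -> S7 p ->
    forall i, HQ p (row i (\matrix_i horizontal_frame Y i p)).
  move=> Up Sp i; have [HYp _] := HY p Up Sp.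
  rewrite rowK /horizontal_frame; case: unlift => [a|] //.
  exact: HQ_vert.
have oF p : U p -> S7 p -> let F := \matrix_i horizontal_frame Y i p in
    F *m F^T = 1%:M.
  move=> Up Sp F; have [_ Y1] := HY p Up Sp.
  by apply/matrixP => i j; rewrite dot_mxE !rowK horizontal_frame_dot // mxE.
split=> //.
- move=> k; apply: smooth_elementary => //.
  have -> : tangent_frame Y k = match fintype.split k with
    | inl i => horizontal_frame Y i | inr a => vert a end.
    by apply/funext => p; rewrite /tangent_frame; case: fintype.split.
  case: fintype.split => [i|a]; last first.
    exact: elementary_field_linear (elementary_field_id U).
  rewrite /horizontal_frame; case: unlift => [a|] //.
  exact: elementary_field_linear.
- move=> p Up Sp; rewrite tangent_frame_mx.
  split; first exact: tangent_basis_free (HF p Up Sp) (oF p Up Sp) Sp.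
  by move=> w; exact: tangentP (HF p Up Sp) (oF p Up Sp) Sp w.
- move=> p Up Sp i j; have [_ Y1] := HY p Up Sp.
  rewrite /tangent_frame (unsplitK (inl i)) (unsplitK (inl j)).
  exact: horizontal_frame_dot.
- move=> p Up Sp w; rewrite tangent_frame_mx col_mxKu.
  exact: horizontalP (HF p Up Sp) (oF p Up Sp) Sp w.
Qed.

(** Project a constant vector [e], horizontal at [q], onto the horizontal spaces. The projection
    equals [e] at [q], so it can be normalised on the open set [U] where its norm is positive. *)
Lemma exists_adapted_frame (q : E) : S7 q ->
  exists U X, @adapted_frame R (4 + 4) 4 3 S7 TS7 HQ U X /\ U q.
Proof.
move=> Sq; have [e e0 He] := horizontal_nonzero q.
pose N p := dot (horizontal_field e p) (horizontal_field e p).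
have eN U : elementary U N.
  by apply: elementary_dot; exact: elementary_horizontal_field.
pose U := [set p | 0 < N p].
have oU : open U.
  apply: (open_comp (f := N) (D := [set x | 0 < x])) => [p _|].
    apply/differentiable_continuous.
    exact: (elementary_derive (eN setT)).1.
  exact: open_gt.
pose Y p := (Num.sqrt (N p))^-1 *: horizontal_field e p.
exists U, (tangent_frame Y); split; last first.
  by rewrite /U /= /N horizontal_field_id // dot_gt0.
apply: adapted_tangent_frame => // [|p Up Sp].
  apply: elementary_fieldZ (elementary_horizontal_field U e).
  by apply: elementary_rsqrt.
have Hp := horizontal_fieldP e Sp; split.
  have [qY VY] := (HQP _ _).1 Hp; apply/HQP; split=> [|a].
    by rewrite dotZr qY mulr0.
  by rewrite dotZr VY mulr0.
rewrite dotZl dotZr mulrA -invfM -expr2 sqr_sqrtr ?ltW //.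
by rewrite mulVf // gt_eqF.
Qed.

End FrameExistence.

Theorem lemma5p1 (R : realType) :
  exists c : R, 0 < c /\
    forall omega : 'rV[R]_(4 + 4) -> ('I_(4 + 3) -> 'rV[R]_(4 + 4)) -> R,
      @is_popp_volume R (4 + 4) 4 3 S7 TS7 HQ dsigma omega <->
      (forall (q : 'rV[R]_(4 + 4)) (v : 'I_(4 + 3) -> 'rV[R]_(4 + 4)),
         S7 q -> (forall j, TS7 q (v j)) -> omega q v = c * dsigma q v).
Proof.
exists 64%:R^-1; split; first by rewrite invr_gt0 ltr0n.
move=> omega; split=> [popp q v Sq Tv|omegaE U X frameX q Uq Sq v Tv].
  (* A Popp volume is constrained at [q] only through adapted frames around [q], so one has to be
     produced. *)
  have [U [X [frameX Uq]]] := exists_adapted_frame Sq.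
  by rewrite (popp U X frameX) // (popp_form_dsigma frameX).
by rewrite omegaE // (popp_form_dsigma frameX).
Qed.
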